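(* Let $n\ge 0$ be an integer and let $A,B\subseteq\{1,2,\dots,n\}$. Then in $K_{n,0}$: $$f_Af_B=\begin{cases}f_A,&A=B,\\0,&A\ne B.\end{cases}$$ Further, $\{f_B\;|\;B\subseteq\{1,2,\dots,n\}\}$ is a basis for $K_{n,0}$ (as a real vector space).
   Context: $K_{n,0}$ is the real associative algebra with unity generated by $e_1,\dots,e_n$ subject to $e_i^2=1$ and $e_ie_j=e_je_i$ for all $i,j\in\{1,\dots,n\}$. For $A=\{i_1<\cdots<i_l\}\subseteq\{1,\dots,n\}$ put $e_A:=e_{i_1}\cdots e_{i_l}$, with $e_{\{\}}:=1$; the elements $e_A$, $A\subseteq\{1,\dots,n\}$, form a basis of $K_{n,0}$ as a real vector space (dimension $2^n$). Operations of conjugation: for $l\in\{1,\dots,n\}$, $U\mapsto U^{(l)}$ is the linear map on $K_{n,0}$ replacing the generator $e_l$ by $-e_l$, i.e. $e_A^{(l)}=-e_A$ if $l\in A$ and $e_A^{(l)}=e_A$ if $l\notin A$. For $B=\{i_1,\dots,i_k\}\subseteq\{1,\dots,n\}$, $U^{(B)}$ denotes the result of applying the conjugations $(i_1),\dots,(i_k)$ successively (they commute), with $U^{(\{\})}:=U$. Define $f:=\frac{1}{2^n}\sum_{A\subseteq\{1,\dots,n\}}e_A\in K_{n,0}$ and $f_B:=f^{(B)}$ for $B\subseteq\{1,\dots,n\}$. *)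

(* Defs.v *)
From HB Require Import structures.
From mathcomp Require Import all_boot all_order all_algebra.
From mathcomp Require Import reals.

Set Implicit Arguments.
Unset Strict Implicit.
Unset Printing Implicit Defensive.

Import GRing.Theory.
Local Open Scope ring_scope.

Definition symdiff (T : finType) (A B : {set T}) : {set T} :=
  [set i | (i \in A) (+) (i \in B)].

Lemma symdiffA (T : finType) : associative (@symdiff T).
Proof. by move=> A B C; apply/setP=> i; rewrite !inE addbA. Qed.

Lemma symdiffC (T : finType) : commutative (@symdiff T).
Proof. by move=> A B; apply/setP=> i; rewrite !inE addbC. Qed.

Lemma symdiff0s (T : finType) : left_id set0 (@symdiff T).
Proof. by move=> A; apply/setP=> i; rewrite !inE. Qed.

Lemma symdiffK (T : finType) (A : {set T}) : involutive (symdiff A).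
Proof. by move=> B; apply/setP=> i; rewrite !inE addKb. Qed.

Lemma symdiff_eq0 (T : finType) (A B : {set T}) :
  (symdiff A B == set0) = (A == B).
Proof.
apply/eqP/eqP => [AB0 | ->]; last by apply/setP=> i; rewrite !inE addbb.
by rewrite -[B](symdiffK A) AB0 symdiffC symdiff0s.
Qed.

(* K_{n,0} is realised on coordinate families (U_A)_A, read as the sum of the
   U_A e_A. The relations force e_A e_B = e_(A symdiff B), whence the product
   below. That this is the algebra presented by the generators and relations
   is Kn0_presentation. The index set {1, ..., n} is 'I_n. *)
Definition Kn0 (R : realType) (n : nat) : Type := {ffun {set 'I_n} -> R^o}.

HB.instance Definition _ (R : realType) n :=
  Vector.copy (Kn0 R n) {ffun {set 'I_n} -> R^o}.

Section Algebra.
Variables (R : realType) (n : nat).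
Local Notation K := (Kn0 R n).

Definition Kn0_one : K := [ffun A : {set 'I_n} => (A == set0)%:R].

Definition Kn0_mul (U V : K) : K :=
  [ffun C : {set 'I_n} => \sum_(A : {set 'I_n}) U A * V (symdiff A C)].

Fact Kn0_mulA : associative Kn0_mul.
Proof.
move=> U V W; apply/ffunP=> C; rewrite !ffunE.
under eq_bigr do rewrite ffunE mulr_sumr.
under [RHS]eq_bigr do rewrite ffunE mulr_suml.
rewrite [RHS]exchange_big /=; apply: eq_bigr => A _.
rewrite [RHS](reindex_inj (inv_inj (symdiffK A))) /=.
apply: eq_bigr => B _.
by rewrite symdiffK mulrA symdiffA (symdiffC B).
Qed.

Fact Kn0_mulC : commutative Kn0_mul.
Proof.
move=> U V; apply/ffunP=> C; rewrite !ffunE.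
rewrite (reindex_inj (inv_inj (symdiffK C))) /=.
apply: eq_bigr => A _.
by rewrite mulrC (symdiffC (symdiff C A)) symdiffK symdiffC.
Qed.

Fact Kn0_mul1 : left_id Kn0_one Kn0_mul.
Proof.
move=> U; apply/ffunP=> C; rewrite !ffunE (bigD1 set0) //= ffunE eqxx mul1r.
rewrite symdiff0s big1 ?addr0 // => A /negPf A0.
by rewrite ffunE A0 mul0r.
Qed.

Fact Kn0_mulDl : left_distributive Kn0_mul +%R.
Proof.
move=> U V W; apply/ffunP=> C; rewrite !ffunE -big_split /=.
by apply: eq_bigr => A _; rewrite ffunE mulrDl.
Qed.

Fact Kn0_one_neq0 : Kn0_one != 0.
Proof.
by apply/eqP=> /ffunP/(_ set0); rewrite !ffunE eqxx; apply/eqP/oner_neq0.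
Qed.

HB.instance Definition _ := GRing.Zmodule_isComNzRing.Build K
  Kn0_mulA Kn0_mulC Kn0_mul1 Kn0_mulDl Kn0_one_neq0.

Fact Kn0_scaleAl (a : R) (U V : K) : a *: (U * V) = (a *: U) * V.
Proof.
apply/ffunP=> C; rewrite !ffunE scaler_sumr.
by apply: eq_bigr => A _; rewrite ffunE scalerAl.
Qed.

HB.instance Definition _ := GRing.Lmodule_isLalgebra.Build R K Kn0_scaleAl.
HB.instance Definition _ := GRing.Lalgebra_isComAlgebra.Build R K.

End Algebra.

Definition gen (R : realType) (n : nat) (i : 'I_n) : Kn0 R n :=
  [ffun A : {set 'I_n} => (A == [set i])%:R].

Definition eA (R : realType) (n : nat) (A : {set 'I_n}) : Kn0 R n :=
  \prod_(i in A) gen R i.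

Definition Kn0_conj1 (R : realType) (n : nat) (l : 'I_n) (U : Kn0 R n) :
    Kn0 R n :=
  [ffun A : {set 'I_n} => if l \in A then - U A else U A].

Definition Kn0_conj (R : realType) (n : nat) (B : {set 'I_n}) (U : Kn0 R n) :
    Kn0 R n :=
  foldr (@Kn0_conj1 R n) U (enum B).

Definition Kn0_f (R : realType) (n : nat) : Kn0 R n :=
  (2 ^+ n)^-1 *: \sum_(A : {set 'I_n}) eA R A.

Definition Kn0_fB (R : realType) (n : nat) (B : {set 'I_n}) : Kn0 R n :=
  Kn0_conj B (Kn0_f R n).

Section Theory.
Variables (R : realType) (n : nat).
Local Notation K := (Kn0 R n).
Implicit Types (A B C : {set 'I_n}) (i j l : 'I_n) (U V : K).

Lemma Kn0_1E A : (1 : K) A = (A == set0)%:R.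
Proof. exact: ffunE. Qed.

Lemma gen_mul l U A : (gen R l * U) A = U (symdiff [set l] A).
Proof.
rewrite [LHS]ffunE (bigD1 [set l]) //= ffunE eqxx mul1r big1 ?addr0 //.
by move=> B /negPf Bl; rewrite ffunE Bl mul0r.
Qed.

Lemma gen_sqr i : gen R i ^+ 2 = 1.
Proof.
apply/ffunP=> A; rewrite expr2 gen_mul !ffunE -symdiff_eq0.
by rewrite -symdiffA (symdiffC A) symdiffK.
Qed.

Lemma genC i j : gen R i * gen R j = gen R j * gen R i.
Proof. exact: mulrC. Qed.

Lemma eA_coord A C : eA R A C = (C == A)%:R.
Proof.
have prod_gen (r : seq 'I_n) D : uniq r ->
    (\prod_(i <- r) gen R i) D = (D == [set i in r])%:R.
  elim: r D => [|i r IHr] D /=; first by rewrite big_nil set_nil Kn0_1E.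
  case/andP=> i_r r_uniq; rewrite big_cons gen_mul IHr //; congr (_%:R).
  rewrite -symdiff_eq0 -[in RHS]symdiff_eq0.
  congr (nat_of_bool (_ == set0)); apply/setP=> j; rewrite !inE.
  case: eqP => [->|_]; rewrite ?(negPf i_r);
    by case: (_ \in D); case: (j \in r).
rewrite /eA -big_enum prod_gen ?enum_uniq //.
by congr (_ == _)%:R; apply/setP=> i; rewrite inE mem_enum.
Qed.

Lemma eA0 : eA R (set0 : {set 'I_n}) = 1.
Proof. exact: big_set0. Qed.

Lemma eA1 i : eA R [set i] = gen R i.
Proof. exact: big_set1. Qed.

Lemma sum_scale_coord (c : {set 'I_n} -> R) A :
  (\sum_B c B *: eA R B) A = c A.
Proof.
rewrite sum_ffunE (bigD1 A) //= big1 ?addr0 => [|B /negPf BA].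
  by rewrite ffunE eA_coord eqxx; apply: mulr1.
by rewrite ffunE eA_coord eq_sym BA scaler0.
Qed.

Lemma Kn0_coordE U : U = \sum_A U A *: eA R A.
Proof. by apply/ffunP=> A; rewrite sum_scale_coord. Qed.

Lemma eA_basis : basis_of {:K} [seq eA R A | A : {set 'I_n}].
Proof.
rewrite basisEdim size_image dimvf; apply/andP; split.
  apply/subvP=> U _; rewrite [U]Kn0_coordE; apply: memv_suml => A _.
  by apply/memvZ/memv_span/image_f.
have -> : dim K = (#|{set 'I_n}| * 1)%N by [].
by rewrite muln1.
Qed.

Fact Kn0_conj1_is_linear l : linear (@Kn0_conj1 R n l).
Proof.
move=> a U V; apply/ffunP=> A; rewrite !ffunE.
by case: ifP => // _; rewrite opprD scalerN.
Qed.

Lemma Kn0_conj1_eA l A :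
  Kn0_conj1 l (eA R A) = if l \in A then - eA R A else eA R A.
Proof.
apply/ffunP=> C; rewrite !ffunE; case: ifPn => lC; case: ifPn => lA;
  rewrite ?ffunE // eA_coord; case: eqP => [CA|_]; rewrite ?oppr0 //.
  by rewrite -CA lC in lA.
by rewrite CA lA in lC.
Qed.

Lemma Kn0_conj1C l m U :
  Kn0_conj1 l (Kn0_conj1 m U) = Kn0_conj1 m (Kn0_conj1 l U).
Proof. by apply/ffunP=> A; rewrite !ffunE; do 2 case: ifP. Qed.

Lemma Kn0_presentation (L : algType R) (g : 'I_n -> L) :
    (forall i, g i ^+ 2 = 1) -> (forall i j, g i * g j = g j * g i) ->
  exists phi : {lrmorphism K -> L},
    (forall i, phi (gen R i) = g i) /\
    (forall psi : {lrmorphism K -> L},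
       (forall i, psi (gen R i) = g i) -> psi =1 phi).
Proof.
move=> g2 gC; pose gA A := \prod_(i in A) g i.
have gAM A B : gA A * gA B = gA (symdiff A B).
  rewrite /gA [X in X * _]big_mkcond [X in _ * X]big_mkcond [RHS]big_mkcond /=.
  rewrite -prodrM_comm; last first.
    move=> i j _ _; case: ifP => _; case: ifP => _;
    by [exact: gC | exact: commr1 | exact/commr_sym/commr1].
  apply: eq_bigr => i _; rewrite inE.
  by case: (i \in A); case: (i \in B); rewrite /= ?mulr1 ?mul1r // -expr2.
pose phi U := \sum_A (U : K) A *: gA A.
have phi_lin : linear phi.
  move=> a U V; rewrite /phi scaler_sumr -big_split /=; apply: eq_bigr => A _.
  by rewrite !ffunE scalerDl scalerA.
have phi_eA A : phi (eA R A) = gA A.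
  rewrite /phi (bigD1 A) //= eA_coord eqxx scale1r big1 ?addr0 //.
  by move=> B /negPf BA; rewrite eA_coord BA scale0r.
have phi_mul : monoid_morphism phi.
  split=> [|U V]; first by rewrite -eA0 phi_eA /gA big_set0.
  rewrite {1}/phi; under eq_bigr do rewrite ffunE scaler_suml.
  rewrite exchange_big /= [RHS]mulr_suml; apply: eq_bigr => A _.
  rewrite mulr_sumr (reindex_inj (inv_inj (symdiffK A))) /=.
  apply: eq_bigr => B _.
  by rewrite symdiffK -scalerAl -scalerAr scalerA gAM.
pose lin := GRing.isLinear.Build R K L *:%R phi phi_lin.
pose mon := GRing.isMonoidMorphism.Build K L phi phi_mul.
pose phiL : {linear K -> L} := HB.pack phi lin.
pose phiM : {lrmorphism K -> L} := HB.pack phi lin mon.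
exists phiM; split=> [i | psi psi_gen U].
  by rewrite -eA1 [LHS]phi_eA /gA big_set1.
rewrite {1}[U]Kn0_coordE linear_sum; apply: eq_bigr => A _.
rewrite linearZ rmorph_prod /=; congr (_ *: _).
by apply: eq_bigr => i _; apply: psi_gen.
Qed.

End Theory.

(* Main.v *)
Require Import Defs.
From mathcomp Require Import all_boot all_order all_algebra.
From mathcomp Require Import reals.
Local Open Scope ring_scope.

(** The basis [e_A] is the group [(Z/2)^n] of subsets under symmetric
    difference, so [K_{n,0}] is its real group algebra. Conjugation by [B]
    multiplies the coordinate at [A] by the character value
    [(-1)^|A ∩ B|], hence [2^n f_B] is the coordinate family of that character
    ([Kn0_fB_coord]), and the [f_B] are the primitive idempotents attached to
    the [2^n] characters of the group.

    Everything then rests on the orthogonality of these characters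
    ([sum_walshM]). Characters being multiplicative, the convolution
    [f_A f_B] is [f_B] times the normalised scalar product of the characters of
    [A] and [B], which is 1 or 0. Since [|A ∩ B|] is symmetric, the same
    relation inverts the passage from the [e_A] to the [f_B]: it gives
    [e_A = \sum_B (-1)^|A ∩ B| f_B] ([eA_fB]). So the [2^n] elements [f_B] span
    a space of dimension [2^n], and form a basis. *)

Import GRing.Theory Num.Theory.

(** The sign [(-1)^|A ∩ B|], written as a product over all indices so that its
    symmetry and its multiplicativity in each argument hold factor by factor. *)
Definition walsh (R : pzRingType) {T : finType} (A B : {set T}) : R :=
  \prod_(i : T) (-1) ^+ ((i \in A) && (i \in B)).

Section Walsh.
Variables (R : numDomainType) (T : finType).
Implicit Types (A B C D : {set T}).
Local Notation walsh := (@walsh R T).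

Lemma walshC A B : walsh A B = walsh B A.
Proof. by apply: eq_bigr => i _; rewrite andbC. Qed.

Lemma walshDl A B D : walsh (symdiff A B) D = walsh A D * walsh B D.
Proof.
rewrite /walsh -big_split; apply: eq_bigr => i _; rewrite inE /=.
by rewrite -signr_addb andb_addl.
Qed.

Lemma walshDr A B D : walsh D (symdiff A B) = walsh D A * walsh D B.
Proof. by rewrite !(walshC D) walshDl. Qed.

Lemma walsh0 D : walsh set0 D = 1.
Proof. by apply: big1 => i _; rewrite inE. Qed.

Lemma walsh1 i D : walsh [set i] D = (-1) ^+ (i \in D).
Proof.
rewrite /walsh (bigD1 i) //= inE eqxx big1 ?mulr1 // => j /negPf ji.
by rewrite inE ji.
Qed.

(** For [i] in [A], adding or removing [i] permutes the subsets [D] and flips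
    the sign of every term, so the sum is its own opposite unless [A] is
    empty. *)
Lemma sum_walsh A : \sum_D walsh D A = (2 ^+ #|T|) *+ (A == set0).
Proof.
have [->|[i iA]] := set_0Vmem A.
  rewrite eqxx; under eq_bigr do rewrite walshC walsh0.
  by rewrite -natrX -[in RHS]cardsT -card_powerset powersetT cardsT sumr_const.
have /negPf-> : A != set0 by apply/set0Pn; exists i.
apply/eqP; rewrite mulr0n -eqNr; apply/eqP.
rewrite [RHS](reindex_inj (inv_inj (symdiffK [set i]))) -sumrN /=.
by apply: eq_bigr => D _; rewrite walshDl walsh1 iA mulN1r.
Qed.

Lemma sum_walshM A B :
  \sum_D walsh D A * walsh D B = (2 ^+ #|T|) *+ (A == B).
Proof. by under eq_bigr do rewrite -walshDr; rewrite sum_walsh symdiff_eq0. Qed.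

End Walsh.

Section Idempotents.
Variables (R : realType) (n : nat).
Implicit Types (A B C : {set 'I_n}) (U : Kn0 R n).

Lemma Kn0_conj_coord B U C : Kn0_conj B U C = walsh R C B * U C.
Proof.
have foldr_conj s :
    foldr (@Kn0_conj1 R n) U s C = (\prod_(i <- s) (-1) ^+ (i \in C)) * U C.
  elim: s => [|i s IHs] /=; first by rewrite big_nil mul1r.
  rewrite ffunE IHs big_cons.
  by case: (i \in C); rewrite ?mul1r // mulN1r mulNr.
rewrite /Kn0_conj foldr_conj big_enum big_mkcond /=; congr (_ * _).
by apply: eq_bigr => i _; rewrite andbC; case: (i \in B).
Qed.

Lemma Kn0_f_coord C : Kn0_f R n C = (2 ^+ n)^-1.
Proof.
have -> : Kn0_f R n C = (2 ^+ n)^-1 * (\sum_A eA R A) C by rewrite ffunE.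
suff -> : (\sum_A eA R A) C = 1 by rewrite mulr1.
rewrite -[RHS](sum_scale_coord (fun=> 1) C).
by under [in RHS]eq_bigr do rewrite scale1r.
Qed.

Lemma Kn0_fB_coord B C : Kn0_fB R B C = walsh R C B / 2 ^+ n.
Proof. by rewrite [LHS]Kn0_conj_coord Kn0_f_coord. Qed.

Lemma exp2_neq0 : (2 ^+ n : R) != 0.
Proof. by rewrite expf_neq0 // pnatr_eq0. Qed.

Lemma Kn0_fB_mul A B :
  Kn0_fB R A * Kn0_fB R B = if A == B then Kn0_fB R A else 0.
Proof.
(* The character of B at [symdiff D C] splits, which pulls its value at C out
   of the convolution and leaves a scalar product of characters. *)
have fAB C : (Kn0_fB R A * Kn0_fB R B) C =
    (\sum_D walsh R D A * walsh R D B) / 2 ^+ n * (walsh R C B / 2 ^+ n).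
  rewrite [LHS]ffunE !mulr_suml; apply: eq_bigr => D _.
  by rewrite !Kn0_fB_coord walshDl -!mulrA; congr (_ * _); rewrite mulrCA.
apply/ffunP=> C; rewrite fAB sum_walshM card_ord.
case: eqP => [->|_]; last by rewrite !mul0r ffunE.
by rewrite divff ?exp2_neq0 // mul1r Kn0_fB_coord.
Qed.

(** Fourier inversion: the matrix of signs [walsh A B] is symmetric, so
    orthogonality of its columns makes it, up to the factor [2^n], its own
    inverse. *)
Lemma eA_fB A : eA R A = \sum_B walsh R A B *: Kn0_fB R B.
Proof.
apply/ffunP=> C; rewrite eA_coord sum_ffunE.
transitivity ((\sum_B walsh R B A * walsh R B C) / 2 ^+ n).
  rewrite sum_walshM card_ord eq_sym.
  by case: eqP => _; rewrite ?mul0r // divff ?exp2_neq0.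
rewrite mulr_suml; apply: eq_bigr => B _.
by rewrite ffunE Kn0_fB_coord (walshC _ _ B A) (walshC _ _ B C) -mulrA.
Qed.

Lemma Kn0_fB_basis :
  basis_of (fullv : {vspace Kn0 R n}) [seq Kn0_fB R B | B : {set 'I_n}].
Proof.
(* By the dimension count it is enough that the span contains each [e_A]. *)
rewrite basisEdim (size_basis (eA_basis R n)) size_image leqnn andbT.
rewrite -(span_basis (eA_basis R n)); apply/span_subvP=> _ /imageP[A _ ->].
rewrite eA_fB; apply: memv_suml => B _.
by apply/memvZ/memv_span/image_f.
Qed.

End Idempotents.

Theorem theorem6p4 (R : realType) (n : nat) :
  (forall A B : {set 'I_n},
     Kn0_fB R A * Kn0_fB R B = if A == B then Kn0_fB R A else 0) /\
  basis_of (fullv : {vspace Kn0 R n}) [seq Kn0_fB R B | B : {set 'I_n}].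
Proof. by split; [exact: Kn0_fB_mul | exact: Kn0_fB_basis]. Qed.
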